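(* Let $E$ and $V$ be Banach spaces, $a<b$ real numbers, and let $f:[a,b]\to L(E,V)$ and $g:[a,b]\to E$ be two regulated functions which have no common points of discontinuity. Let $\eta_{0}\ge\eta_{1}\ge\ldots$ and $\theta_{0}\ge\theta_{1}\ge\ldots$ be two sequences of positive numbers such that $\eta_{k}\downarrow0$ and $\theta_{k}\downarrow0$ as $k\to+\infty$. Define $\eta_{-1}:=\frac{1}{2}\sup_{a\le t\le b}\|f(t)-f(a)\|_{L(E,V)}$ and $$S:=4\sum_{k=0}^{+\infty}3^{k}\eta_{k-1}\cdot \mathrm{TV}^{\theta_{k}/4}(g,[a,b])+4\sum_{k=0}^{+\infty}3^{k}\theta_{k}\cdot \mathrm{TV}^{\eta_{k}/4}(f,[a,b]).$$ If $S<+\infty$ then the Riemann-Stieltjes integral $\int_{a}^{b}f\,\mathrm{d}g$ exists and $$\left\|\int_{a}^{b}f\,\mathrm{d}g-f(a)[g(b)-g(a)]\right\|_{V}\le S.$$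
   Context: $L(E,V)$ is the Banach space of continuous linear maps $F:E\to V$ with norm $\|F\|_{L(E,V)}=\sup_{\|e\|_E=1}\|Fe\|_V$. A function on $[a,b]$ with values in a Banach space is regulated if it has right limits at every $t\in[a,b)$ and left limits at every $t\in(a,b]$. For a function $h:[a,b]\to W$ into a Banach space $W$ and $\delta\ge0$ the truncated variation is $$\mathrm{TV}^{\delta}(h,[a,b]):=\sup_{n}\ \sup_{a\le t_{0}<t_{1}<\ldots<t_{n}\le b}\ \sum_{i=1}^{n}\max\{\|h(t_{i})-h(t_{i-1})\|_W-\delta,0\}.$$ $f(\xi)[g(t)-g(s)]\in V$ denotes the value of the linear map $f(\xi)$ at the vector $g(t)-g(s)$. The Riemann-Stieltjes integral $\int_a^b f\,\mathrm{d}g\in V$ is the common limit (if it exists) of the sums $\sum_{i}f(\xi_{i})[g(t_{i})-g(t_{i-1})]$ over all sequences of tagged partitions $a=t_0<t_1<\dots<t_n=b$, $\xi_i\in[t_{i-1},t_i]$, with mesh $\max_i(t_i-t_{i-1})$ tending to $0$. *)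

(* Defs.v *)
From HB Require Import structures.
From mathcomp Require Import all_boot all_order all_algebra.
From mathcomp Require Import all_classical all_reals all_analysis.

Set Implicit Arguments.
Unset Strict Implicit.
Unset Printing Implicit Defensive.

Import Order.TTheory GRing.Theory Num.Theory.
Import numFieldNormedType.Exports.

Local Open Scope classical_set_scope.
Local Open Scope ring_scope.

Definition cont_linear {R : realType} {E V : normedModType R}
    : {pred E -> V} :=
  fun F => `[< linear F /\ continuous F >].

(* The space L(E, V). The type is tagged by [E] and [V] themselves (not by
   their carriers) so that the operator norm below is canonically inferred. *)
Record clinear (R : realType) (E V : normedModType R) := Clinear {
  clinear_val :> E -> V ;
  clinear_valP : clinear_val \in @cont_linear R E V }.

Section clinear_space.
Context {R : realType} {E V : normedModType R}.

HB.instance Definition _ := [isSub for @clinear_val R E V].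
HB.instance Definition _ := [Choice of clinear E V by <:].

Lemma cont_linearP (F : E -> V) :
  reflect (linear F /\ continuous F) (F \in cont_linear).
Proof. exact: asboolP. Qed.

Lemma cont_linear_submod : submod_closed (@cont_linear R E V).
Proof.
split.
  apply/cont_linearP; split => [k x y|x]; last exact: cvg_cst.
  by rewrite /GRing.zero/= scaler0 addr0.
move=> k F G /cont_linearP[Fl Fc] /cont_linearP[Gl Gc].
apply/cont_linearP; split => [c x y|x].
  rewrite !fctE Fl Gl !scalerDr !scalerA addrACA; congr (_ + _ + _).
  by rewrite mulrC.
by apply: cvgD; [apply: cvgZr; exact: Fc|exact: Gc].
Qed.

HB.instance Definition _ :=
  GRing.isSubmodClosed.Build R (E -> V) cont_linear cont_linear_submod.
HB.instance Definition _ := [SubChoice_isSubLmodule of clinear E V by <:].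

Lemma clinear_linear (F : clinear E V) : linear F.
Proof. by have /cont_linearP[] := clinear_valP F. Qed.

Lemma clinear_continuous (F : clinear E V) : continuous F.
Proof. by have /cont_linearP[] := clinear_valP F. Qed.

HB.instance Definition _ (F : clinear E V) :=
  GRing.isLinear.Build R E V *:%R F (clinear_linear F).

(* When [E] is the zero space the set is empty and [sup set0 = 0]. *)
Definition opnorm (F : clinear E V) : R :=
  sup [set `|F e| | e in [set e | `|e| = 1]].

Lemma opnorm_has_ubound (F : clinear E V) :
  has_ubound [set `|F e| | e in [set e | `|e| = 1]].
Proof.
have : bounded_near F (nbhs (0 : E)).
  exact/continuous_linear_bounded/clinear_continuous.
move/linear_boundedP/pinfty_ex_gt0 => [M M0 FM].
by exists M => _ [e /= e1 <-]; rewrite (le_trans (FM e))// e1 mulr1.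
Qed.

Lemma opnorm_ge0 (F : clinear E V) : 0 <= opnorm F.
Proof.
rewrite /opnorm; set A := [set _ | _ in _].
have [->|/set0P[x Ax]] := eqVneq A set0; first by rewrite sup0.
apply: (@le_trans _ _ x); first by case: Ax => e _ <-.
exact/ub_le_sup/Ax/opnorm_has_ubound.
Qed.

Lemma opnorm_bound (F : clinear E V) (e : E) : `|F e| <= opnorm F * `|e|.
Proof.
have [->|e0] := eqVneq e 0; first by rewrite linear0 !normr0 mulr0.
rewrite -ler_pdivrMr ?normr_gt0//.
have -> : `|F e| / `|e| = `|F (`|e|^-1 *: e)|.
  by rewrite linearZ normrZ normfV normr_id mulrC.
apply: ub_le_sup; first exact: opnorm_has_ubound.
exists (`|e|^-1 *: e) => //=.
by rewrite normrZ normfV normr_id mulVf ?normr_eq0.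
Qed.

Lemma opnorm_le (F : clinear E V) (M : R) : 0 <= M ->
  (forall e, `|F e| <= M * `|e|) -> opnorm F <= M.
Proof.
move=> M0 FM; rewrite /opnorm; set A := [set _ | _ in _].
have [->|/set0P A0] := eqVneq A set0; first by rewrite sup0.
by apply: ge_sup => // _ [e /= e1 <-]; rewrite (le_trans (FM e))// e1 mulr1.
Qed.

Lemma opnormD (F G : clinear E V) : opnorm (F + G) <= opnorm F + opnorm G.
Proof.
apply: opnorm_le => [|e]; first by rewrite addr_ge0 ?opnorm_ge0.
rewrite mulrDl (le_trans (ler_normD _ _))//.
by apply: lerD; exact: opnorm_bound.
Qed.

Lemma opnormZ_le (k : R) (F : clinear E V) : opnorm (k *: F) <= `|k| * opnorm F.
Proof.
apply: opnorm_le => [|e]; first by rewrite mulr_ge0 ?opnorm_ge0.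
rewrite (_ : (k *: F) e = k *: F e)// normrZ -mulrA.
by apply: ler_wpM2l => //; exact: opnorm_bound.
Qed.

Lemma opnormZ (k : R) (F : clinear E V) : opnorm (k *: F) = `|k| * opnorm F.
Proof.
apply/eqP; rewrite eq_le opnormZ_le/=.
have [->|k0] := eqVneq k 0; first by rewrite normr0 mul0r opnorm_ge0.
rewrite -ler_pdivlMl ?normr_gt0// -normfV.
by rewrite (le_trans _ (opnormZ_le _ _))// scalerA mulVf// scale1r.
Qed.

Lemma opnorm_eq0 (F : clinear E V) : opnorm F = 0 -> F = 0.
Proof.
move=> F0; apply/val_inj/funext => e /=.
apply/normr0_eq0/eqP; rewrite eq_le normr_ge0 andbT.
by rewrite (le_trans (opnorm_bound _ _))// F0 mul0r.
Qed.

HB.instance Definition _ :=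
  Lmodule_isNormed.Build R (clinear E V) opnormD opnormZ opnorm_eq0.

Lemma clinear_normE (F : clinear E V) : `|F| = opnorm F.
Proof. by []. Qed.

End clinear_space.

Section clinear_complete.
Context {R : realType} {E : normedModType R} {V : completeNormedModType R}.

Lemma clinear_cauchy_cvg (F : set_system (clinear E V)) :
  ProperFilter F -> cauchy F -> cvg F.
Proof.
move=> FF /cauchy_ballP Fc.
pose ev (e : E) (G : clinear E V) : V := G e.
have cvgF (e : E) : cvg (ev e @ F).
  apply: cauchy_cvg; apply/cauchy_ballP => eps eps0.
  have d0 : 0 < eps / (`|e| + 1) by rewrite divr_gt0// ltr_wpDl.
  have [[A B] [/= FA FB] AB] := Fc _ d0.
  exists (ev e @` A, ev e @` B) => /=.
    by split; [apply: filterS FA|apply: filterS FB] => G GA; exists G.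
  move=> [_ _] /= [[G AG <-] [H BH <-]].
  have := AB (G, H) (conj AG BH).
  rewrite -!ball_normE/= => GH.
  rewrite (_ : G e - H e = (G - H) e)// (le_lt_trans (opnorm_bound _ _))//.
  rewrite (@le_lt_trans _ _ (`|G - H| * (`|e| + 1)))//.
    by apply: ler_wpM2l; [exact: opnorm_ge0|rewrite lerDl ler01].
  by rewrite -ltr_pdivlMr// ltr_wpDl.
pose L (e : E) := lim (ev e @ F).
have Ll : linear L.
  move=> k x y; apply: cvg_lim => //.
  have : (k *: ev x G + ev y G) @[G --> F] --> k *: L x + L y.
    by apply: cvgD; [apply: cvgZl_tmp|]; exact: cvgF.
  apply: cvg_trans; apply: near_eq_cvg; apply: nearW => G.
  by rewrite /ev/= clinear_linear.
have LF eps : 0 < eps ->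
    \forall G \near F, forall e, `|L e - ev e G| <= eps * `|e|.
  move=> eps0; have [[A B] [/= FA FB] AB] := Fc _ eps0.
  apply: filterS FB => G BG e.
  have Le : `|ev e H - ev e G| @[H --> F] --> `|L e - ev e G|.
    by apply: cvg_norm; apply: cvgB; [exact: cvgF|exact: cvg_cst].
  rewrite -(cvg_lim _ Le)//; apply: limr_le.
    by apply/cvg_ex; eexists; exact: Le.
  apply: filterS FA => H AH.
  have := AB (H, G) (conj AH BG); rewrite -ball_normE/= => HG.
  rewrite /ev (_ : H e - G e = (H - G) e)// (le_trans (opnorm_bound _ _))//.
  by rewrite ler_wpM2r// ltW.
pose Llin : {linear E -> V} := HB.pack L (GRing.isLinear.Build _ _ _ _ _ Ll).
have Lc : continuous L.
  have [G0 LG0] := filter_ex (LF 1 ltr01).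
  apply: (@bounded_linear_continuous _ _ _ Llin); apply/linear_boundedP.
  exists (1 + opnorm G0); split=> [|r /ltW r1 e]; first exact: num_real.
  rewrite -[Llin e](subrK (G0 e)) (le_trans (ler_normD _ _))//.
  rewrite (le_trans (lerD (LG0 e) (opnorm_bound G0 e)))// -mulrDl.
  exact: ler_wpM2r.
have LP : L \in @cont_linear R E V by apply/cont_linearP.
apply/cvg_ex; exists (Clinear LP); apply/cvgrPdist_le => eps eps0.
apply: filterS (LF _ eps0) => G LG.
by apply: opnorm_le; [exact: ltW|exact: LG].
Qed.

HB.instance Definition _ :=
  Uniform_isComplete.Build (clinear E V) clinear_cauchy_cvg.

End clinear_complete.

Section functions.
Context {R : realType} {W : normedModType R}.
Implicit Types (a b d t : R) (h : R -> W).

(* A function on [a, b] is represented by a total function on R; the notions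
   below depend on its values on [a, b] only. *)
Definition regulated a b h :=
  (forall t, a <= t < b -> cvg (h x @[x --> t^'+])) /\
  (forall t, a < t <= b -> cvg (h x @[x --> t^'-])).

Definition discontinuities a b h : set R :=
  [set t | t \in `[a, b] /\
    ~ (h x @[x --> within [set` `[a, b]] (nbhs t)] --> h t)].

Definition truncated_variation d h a b : \bar R :=
  ereal_sup [set z | exists (n : nat) (t : nat -> R),
    [/\ a <= t 0%N, forall i, (i < n)%N -> t i < t i.+1, t n <= b &
        z = (\sum_(i < n) Num.max (`|h (t i.+1) - h (t i)| - d) 0)%:E]].

End functions.

(* Only the points of index at most [tp_size] and the tags of index less than
   [tp_size] are meaningful. *)
Record tagged_partition (R : realType) (a b : R) := TaggedPartition {
  tp_size : nat ;
  tp_point : nat -> R ;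
  tp_tag : nat -> R ;
  tp_point0 : tp_point 0%N = a ;
  tp_pointn : tp_point tp_size = b ;
  tp_point_lt : forall i, (i < tp_size)%N -> tp_point i < tp_point i.+1 ;
  tp_tag_in : forall i, (i < tp_size)%N ->
    tp_point i <= tp_tag i <= tp_point i.+1 }.

Section riemann_stieltjes.
Context {R : realType} {E V : normedModType R}.
Implicit Types (a b : R) (f : R -> clinear E V) (g : R -> E).

Definition mesh a b (P : tagged_partition a b) : R :=
  \big[Num.max/0]_(i < tp_size P) (tp_point P i.+1 - tp_point P i).

Definition RS_sum a b f g (P : tagged_partition a b) : V :=
  \sum_(i < tp_size P)
    f (tp_tag P i) (g (tp_point P i.+1) - g (tp_point P i)).

Definition is_RS_integral a b f g (I : V) :=
  forall P : nat -> tagged_partition a b,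
    mesh (P n) @[n --> \oo] --> 0 -> RS_sum f g (P n) @[n --> \oo] --> I.

Lemma mesh_uniform a b n : a < b ->
  exists P : tagged_partition a b, mesh P = (b - a) / n.+1%:R.
Proof.
move=> ab; pose p i := a + i%:R * ((b - a) / n.+1%:R).
have pS i : p i.+1 - p i = (b - a) / n.+1%:R.
  by rewrite opprD addrACA subrr add0r -mulrBl -natrB// subSnn mul1r.
have mesh_gt0 : 0 < (b - a) / n.+1%:R by rewrite divr_gt0 ?subr_gt0.
have p0 : p 0%N = a by rewrite /p mul0r addr0.
have pn : p n.+1 = b by rewrite /p mulrCA divff// mulr1 addrC subrK.
have plt i : (i < n.+1)%N -> p i < p i.+1 by move=> _; rewrite -subr_gt0 pS.
have ptag i : (i < n.+1)%N -> p i <= p i <= p i.+1.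
  by move=> /plt/ltW ->; rewrite lexx.
exists (TaggedPartition p0 pn plt ptag); rewrite /mesh/=.
apply/eqP; rewrite eq_le; apply/andP; split.
  by apply: bigmax_le => [|i _]; [exact: ltW|rewrite pS].
by rewrite big_ord_recl pS le_max lexx.
Qed.

Lemma RS_integral_unique a b f g (I J : V) : a < b ->
  is_RS_integral a b f g I -> is_RS_integral a b f g J -> I = J.
Proof.
move=> ab fgI fgJ.
have /choice[P meshP] : forall n, exists P : tagged_partition a b,
  mesh P = (b - a) / n.+1%:R by move=> n; exact: mesh_uniform.
have P0 : mesh (P n) @[n --> \oo] --> 0.
  under eq_fun do rewrite meshP.
  by rewrite -(mulr0 (b - a)); apply: cvgZl_tmp; exact: cvg_harmonic.
by rewrite -(cvg_lim _ (fgI _ P0))// -(cvg_lim _ (fgJ _ P0)).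
Qed.

(* [eta_pred a b f eta k] is eta_{k-1}, where
   eta_{-1} := 1/2 sup_{a <= t <= b} |f t - f a|. The supremum is taken in
   \bar R (a regulated [f] is bounded, so it is then finite). *)
Definition eta_pred a b f (eta : nat -> R) (k : nat) : \bar R :=
  if k is k'.+1 then (eta k')%:E
  else (2^-1%:E * ereal_sup [set `|f t - f a|%:E | t in [set` `[a, b]]])%E.

Definition S_bound a b f g (eta theta : nat -> R) : \bar R :=
  (4%:E * (\sum_(0 <= k <oo)
     (3 ^+ k)%:E * eta_pred a b f eta k * truncated_variation (theta k / 4) g a b)
   + 4%:E * (\sum_(0 <= k <oo)
     (3 ^+ k)%:E * (theta k)%:E * truncated_variation (eta k / 4) f a b))%E.

End riemann_stieltjes.

(* Main.v *)
(* Fix thresholds [eta k] for f and [theta k] for g. Along any increasing list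
   of times, freezing h until it has moved by more than [d / 2] gives a step
   function within [d / 2] of h whose variation is at most twice the
   [d / 4]-truncated variation of h. In an increment sum
   [\sum_i (f x_i - f x_0) (g y_i - g y_(i-1))] one replaces alternately g and f
   by these step functions for [theta 0], [eta 0], [theta 1], [eta 1], and so on:
   a replacement in the integrator costs the oscillation of the current residual
   of f times the variation of a step function, and Abel summation gives the
   symmetric estimate for a replacement in the integrand. After r rounds what is
   left of a sum with n terms is at most [n * eta r * theta r], so letting r tend
   to infinity bounds [RS_sum f g P - f a (g b - g a)] by S for every P.
   For existence, start the procedure at a large level N. As f and g have no
   common discontinuity, on every sufficiently short interval f oscillates by at
   most [eta N] or g by at most [theta N], so the difference between a sum and
   its refinement on that interval is bounded by a tail of S; truncated variation
   is superadditive, hence these tails add up to a tail of S over [a, b]. *)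

Require Import Defs.
From mathcomp Require Import all_boot all_order all_algebra.
From mathcomp Require Import all_classical all_reals all_analysis.
From mathcomp Require Import ring lra.

Set Implicit Arguments.
Unset Strict Implicit.
Unset Printing Implicit Defensive.

Import Order.TTheory GRing.Theory Num.Theory.
Import numFieldNormedType.Exports.

Local Open Scope classical_set_scope.
Local Open Scope ring_scope.

(** * Truncated variation: nondecreasing chains, monotonicity, superadditivity *)

Section truncated_variation_theory.
Context {R : realType} {W : normedModType R}.
Implicit Types (c d e : R) (h : R -> W) (t : nat -> R).

Lemma nd_chain_le n t : (forall i, (i < n)%N -> t i <= t i.+1) ->
  t 0%N <= t n.
Proof.
elim: n => // n IHn tn.
by apply: le_trans (IHn _) (tn _ _) => // i /leqW; exact: tn.
Qed.

Lemma exists_strict_chain h d n t : 0 <= d ->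
  (forall i, (i < n)%N -> t i <= t i.+1) ->
  exists m s, [/\ s 0%N = t 0%N, s m = t n,
    forall i, (i < m)%N -> s i < s i.+1 &
    \sum_(i < m) Num.max (`|h (s i.+1) - h (s i)| - d) 0 =
    \sum_(i < n) Num.max (`|h (t i.+1) - h (t i)| - d) 0].
Proof.
move=> d0; elim: n => [|n IHn] tn.
  by exists 0%N, t; split => //; rewrite !big_ord0.
have [|m [s [s0 sm slt ssum]]] := IHn; first by move=> i /leqW; exact: tn.
have := tn n (ltnSn n); rewrite le_eqVlt => /predU1P[tnS|tnS].
  exists m, s; split => //; first by rewrite sm.
  rewrite big_ord_recr/= -ssum -tnS subrr normr0 sub0r max_r ?addr0//.
  by rewrite oppr_le0.
pose s' i := if (i <= m)%N then s i else t n.+1.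
have s'm i : (i <= m)%N -> s' i = s i by rewrite /s' => ->.
have s'mS : s' m.+1 = t n.+1 by rewrite /s' ltnn.
exists m.+1, s'; split.
- by rewrite s'm.
- exact: s'mS.
- move=> i; rewrite ltnS leq_eqVlt => /predU1P[->|im].
    by rewrite s'mS s'm// sm.
  by rewrite !s'm ?(ltnW im)//; exact: slt.
- rewrite !big_ord_recr/= s'mS s'm// sm -ssum; congr (_ + _).
  by apply: eq_bigr => i _; rewrite !s'm// ltnW.
Qed.

Lemma truncated_sum_le h d c e n t : 0 <= d -> c <= t 0%N -> t n <= e ->
  (forall i, (i < n)%N -> t i <= t i.+1) ->
  ((\sum_(i < n) Num.max (`|h (t i.+1) - h (t i)| - d) 0)%:E
    <= truncated_variation d h c e)%E.
Proof.
move=> d0 ct te tn; have [m [s [s0 sm slt <-]]] := exists_strict_chain h d0 tn.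
by apply: ereal_sup_ubound; exists m, s; split; rewrite ?s0 ?sm.
Qed.

Lemma truncated_variation_ge0 h d c e : 0 <= d -> c <= e ->
  (0 <= truncated_variation d h c e)%E.
Proof.
move=> d0 ce; have := @truncated_sum_le h d c e 0 (fun=> c).
by rewrite big_ord0; apply.
Qed.

Lemma le_truncated_variation h d d' c c' e e' : d' <= d -> c' <= c -> e <= e' ->
  (truncated_variation d h c e <= truncated_variation d' h c' e')%E.
Proof.
move=> dd cc ee; apply: ge_ereal_sup => _ [n [t [ct tlt te ->]]].
apply: (@le_trans _ _ (\sum_(i < n) Num.max (`|h (t i.+1) - h (t i)| - d') 0)%:E).
  by rewrite lee_fin; apply: ler_sum => i _; rewrite le_max2// lerB.
apply: ereal_sup_ubound; exists n, t; split => //.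
- exact: le_trans ct.
- exact: le_trans te _.
Qed.

(** A chain in [[c, m]] followed by one in [[m, e]] is a chain in [[c, e]]; the increment joining
    them adds a nonnegative term. *)
Lemma truncated_variation_superadd h d c m e : 0 <= d -> c <= m -> m <= e ->
  (truncated_variation d h c m + truncated_variation d h m e
    <= truncated_variation d h c e)%E.
Proof.
move=> d0 cm me.
have [->|Tfin] := eqVneq (truncated_variation d h c e) +oo%E.
  by rewrite leey.
have fin x y : c <= x -> x <= y -> y <= e ->
    truncated_variation d h x y \is a fin_num.
  move=> cx xy ye; rewrite ge0_fin_numE ?truncated_variation_ge0//.
  apply: le_lt_trans (le_truncated_variation _ (lexx d) cx ye) _.
  by rewrite ltey.
have [fcm fme] := (fin c m (lexx c) cm me, fin m e cm me (lexx e)).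
rewrite addeC -leeBrDr//; apply: ge_ereal_sup => _ [n2 [t2 [mt2 lt2 t2e ->]]].
rewrite leeBrDr// addeC -leeBrDr//.
apply: ge_ereal_sup => _ [n1 [t1 [ct1 lt1 t1m ->]]].
rewrite leeBrDr// -EFinD.
(* Increment [n1] is the junction from [t1 n1] to [t2 0]; it may be degenerate, which
   [truncated_sum_le] allows. *)
pose t i := if (i <= n1)%N then t1 i else t2 (i - n1.+1)%N.
have tl i : (i <= n1)%N -> t i = t1 i by rewrite /t => ->.
have tr i : t (n1.+1 + i)%N = t2 i by rewrite /t ltnNge leq_addr/= addKn.
have tmid : t1 n1 <= t2 0%N by exact: le_trans mt2.
apply: (@le_trans _ _ (\sum_(i < n1.+1 + n2)
    Num.max (`|h (t i.+1) - h (t i)| - d) 0)%:E).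
  rewrite lee_fin big_split_ord/=; apply: lerD; last first.
    by apply: ler_sum => i _; rewrite -addnS !tr.
  rewrite big_ord_recr/= ler_wpDr ?le_max ?lexx ?orbT//.
  by apply: ler_sum => i _; rewrite !tl// ltnW.
apply: truncated_sum_le; rewrite ?tr//.
move=> i; have [ltin1 _|ltn1i|-> _] := ltngtP i n1.
- by rewrite !tl ?ltW ?lt1// ltnW.
- rewrite -{1}(subnKC ltn1i) ltn_add2l => in2.
  by rewrite -(subnKC ltn1i) -addnS !tr ltW ?lt2.
- by rewrite tl// -[n1.+1]addn0 tr.
Qed.

Lemma sum_truncated_variation_le h d n t : 0 <= d ->
  (forall i, (i < n)%N -> t i <= t i.+1) ->
  (\sum_(i < n) truncated_variation d h (t i) (t i.+1)
    <= truncated_variation d h (t 0%N) (t n))%E.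
Proof.
move=> d0; elim: n => [|n IHn] tn.
  by rewrite big_ord0 truncated_variation_ge0.
rewrite big_ord_recr/=.
apply: le_trans (truncated_variation_superadd h d0 (_ : t 0%N <= t n) _).
- by apply: leeD => //; apply: IHn => i /leqW; exact: tn.
- by apply: nd_chain_le => i /leqW; exact: tn.
- exact: tn.
Qed.

End truncated_variation_theory.

Lemma subrBB_split (Z : zmodType) (x x' y y' : Z) :
  (x' - y') + ((x - x') - (y - y')) = x - y.
Proof. by rewrite [_ - (y - y')]/(_ + - _) opprB addrACA subrKC addKr. Qed.

(** * Step functions obtained by freezing a function along a list of times *)

Section greedy.
Context {R : realType} {W : normedModType R}.
Implicit Types (c d e r : R) (h : R -> W) (t : nat -> R).

Fixpoint greedy h t r i : R :=
  if i is j.+1 then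
    if r < `|h (t i) - h (greedy h t r j)| then t i else greedy h t r j
  else t 0%N.

Lemma greedy_le h t r n i : (forall i, (i < n)%N -> t i <= t i.+1) ->
  (i <= n)%N -> greedy h t r i <= t i.
Proof.
move=> tn; elim: i => // i IHi /= ltin; case: ifP => // _.
exact: le_trans (IHi (ltnW ltin)) (tn i ltin).
Qed.

Lemma greedy_nd h t r n i : (forall i, (i < n)%N -> t i <= t i.+1) ->
  (i < n)%N -> greedy h t r i <= greedy h t r i.+1.
Proof.
move=> tn ltin /=; case: ifP => // _.
exact: le_trans (greedy_le h r tn (ltnW ltin)) (tn i ltin).
Qed.

Lemma greedy_dist h t r i : 0 <= r -> `|h (t i) - h (greedy h t r i)| <= r.
Proof.
move=> r0; case: i => [|i]; first by rewrite subrr normr0.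
by rewrite /=; case: ltP => //; rewrite subrr normr0.
Qed.

(* Each jump of [h \o greedy h t (d / 2)] is zero or exceeds [d / 2], so that
   subtracting [d / 4] from it at most halves it. *)
Lemma greedy_variation h t d c e n : 0 <= d -> c <= t 0%N -> t n <= e ->
  (forall i, (i < n)%N -> t i <= t i.+1) ->
  truncated_variation (d / 4) h c e \is a fin_num ->
  \sum_(i < n) `|h (greedy h t (d / 2) i.+1) - h (greedy h t (d / 2) i)|
    <= 2 * fine (truncated_variation (d / 4) h c e).
Proof.
move=> d0 ct te tn fin; set s := greedy h t (d / 2).
have : ((\sum_(i < n) Num.max (`|h (s i.+1) - h (s i)| - d / 4) 0)%:E
    <= truncated_variation (d / 4) h c e)%E.
  apply: truncated_sum_le => //.
  - by rewrite divr_ge0.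
  - exact: le_trans (greedy_le _ _ tn (leqnn n)) te.
  - by move=> i; exact: greedy_nd.
rewrite -(fineK fin) lee_fin => /(ler_wpM2l (ler0n R 2)).
apply: le_trans; rewrite mulr_sumr; apply: ler_sum => i _.
rewrite /s/=; case: ltP => [jump|_]; last first.
  by rewrite subrr normr0 mulr_ge0// le_max lexx orbT.
by rewrite maxr_pMr//; rewrite le_max; apply/orP; left; lra.
Qed.

End greedy.

(** * Increment sums and Abel summation *)

Section increment_sums.
Context {R : realType} {E V : normedModType R}.
Implicit Types (U : nat -> clinear E V) (X : nat -> E) (n : nat).

(** [U i.+1] is the value on cell [i]; [U 0] is a base value that belongs to no cell. *)
Definition incr_sum n U X : V :=
  \sum_(i < n) (U i.+1 - U 0%N) (X i.+1 - X i).

Lemma clinearBl (F G : clinear E V) x : (F - G) x = F x - G x.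
Proof. by []. Qed.

Lemma clinearDl (F G : clinear E V) x : (F + G) x = F x + G x.
Proof. by []. Qed.

Lemma clinearDr (F : clinear E V) x y : F (x + y) = F x + F y.
Proof. exact: linearD. Qed.

Lemma clinear_norm_le (F : clinear E V) x : `|F x| <= `|F| * `|x|.
Proof. exact: opnorm_bound. Qed.

Lemma incr_sumS n U X :
  incr_sum n.+1 U X = incr_sum n U X + (U n.+1 - U 0%N) (X n.+1 - X n).
Proof. by rewrite /incr_sum big_ord_recr. Qed.

(** Each increment of [U] is paired with all increments of [X] from its index on, which telescope to
    [X n - X i]. *)
Lemma incr_sum_abel n U X :
  incr_sum n U X = \sum_(i < n) (U i.+1 - U i) (X n - X i).
Proof.
elim: n => [|n IHn]; first by rewrite /incr_sum !big_ord0.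
rewrite incr_sumS big_ord_recr {}IHn.
have -> : U n.+1 - U 0%N = \sum_(i < n) (U i.+1 - U i) + (U n.+1 - U n).
  elim: n => [|n IHn]; first by rewrite big_ord0 add0r.
  by rewrite big_ord_recr/= -IHn [RHS]addrC [RHS]addrA subrK.
rewrite [in LHS]clinearDl addrA; congr (_ + _).
have -> : (\sum_(i < n) (U i.+1 - U i)) (X n.+1 - X n) =
    \sum_(i < n) (U i.+1 - U i) (X n.+1 - X n).
  by elim/big_ind2: _ => // F1 x1 F2 x2 <- <-.
rewrite -big_split; apply: eq_bigr => i _.
apply: etrans (esym (clinearDr _ _ _)) _.
by congr (clinear_val _ _); rewrite addrC addrA subrK.
Qed.

Lemma incr_sum_lel n U X (m : R) :
  (forall i, (i <= n)%N -> `|U i - U 0%N| <= m) ->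
  `|incr_sum n U X| <= m * \sum_(i < n) `|X i.+1 - X i|.
Proof.
move=> Um; rewrite mulr_sumr; apply: le_trans (ler_norm_sum _ _ _) _.
apply: ler_sum => i _; apply: le_trans (clinear_norm_le _ _) _.
by apply: ler_wpM2r => //; exact: Um.
Qed.

(** After Abel summation the roles are exchanged: oscillation of the integrator, variation of the
    integrand. *)
Lemma incr_sum_ler n U X (m : R) :
  (forall i, (i <= n)%N -> `|X n - X i| <= m) ->
  `|incr_sum n U X| <= m * \sum_(i < n) `|U i.+1 - U i|.
Proof.
move=> Xm; rewrite incr_sum_abel mulr_sumr.
apply: le_trans (ler_norm_sum _ _ _) _.
apply: ler_sum => i _; apply: le_trans (clinear_norm_le _ _) _.
by rewrite mulrC; apply: ler_wpM2r => //; exact/Xm/ltnW.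
Qed.

Lemma incr_sumBl n U U' X :
  incr_sum n U X = incr_sum n U' X + incr_sum n (fun i => U i - U' i) X.
Proof.
rewrite -big_split; apply: eq_bigr => i _.
apply: etrans (clinearDl _ _ _).
by congr (clinear_val _ _); rewrite subrBB_split.
Qed.

Lemma incr_sumBr n U X X' :
  incr_sum n U X = incr_sum n U X' + incr_sum n U (fun i => X i - X' i).
Proof.
rewrite -big_split; apply: eq_bigr => i _.
apply: etrans (clinearDr _ _ _).
by congr (clinear_val _ _); rewrite subrBB_split.
Qed.

End increment_sums.

(** * Residuals of the step approximations *)

Section residual.
Context {R : realType} {W : normedModType R}.
Implicit Types (c d e : R) (h : R -> W) (t : nat -> R).

Definition residual h t d i : W := h (t i) - h (greedy h t (d / 2) i).

Lemma residual_dist h t d i j : 0 <= d ->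
  `|residual h t d i - residual h t d j| <= d.
Proof.
move=> d0; have d20 : 0 <= d / 2 by rewrite divr_ge0.
apply: le_trans (ler_normB _ _) _.
by apply: le_trans (lerD (greedy_dist h t i d20) (greedy_dist h t j d20)) _; lra.
Qed.

(** The value [h (t i)] cancels, leaving a difference of two step functions. Each has variation at
    most twice a truncated variation, and the smaller threshold gives the larger one; hence the
    factor 4. *)
Lemma residualB_variation h t d d' c e n : 0 <= d' -> d' <= d ->
  c <= t 0%N -> t n <= e -> (forall i, (i < n)%N -> t i <= t i.+1) ->
  truncated_variation (d' / 4) h c e \is a fin_num ->
  \sum_(i < n) `|(residual h t d i.+1 - residual h t d' i.+1) -
                 (residual h t d i - residual h t d' i)|
    <= 4 * fine (truncated_variation (d' / 4) h c e).
Proof.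
move=> d'0 dd ct te tn fin'.
have d0 := le_trans d'0 dd.
have ce : c <= e := le_trans ct (le_trans (nd_chain_le tn) te).
have d4 : 0 <= d / 4 by rewrite divr_ge0.
have leT : (truncated_variation (d / 4) h c e
    <= truncated_variation (d' / 4) h c e)%E.
  by apply: le_truncated_variation => //; rewrite ler_pM2r.
have fin : truncated_variation (d / 4) h c e \is a fin_num.
  rewrite ge0_fin_numE ?truncated_variation_ge0// (le_lt_trans leT)//.
  by rewrite ltey_eq fin'.
have V1 := greedy_variation d0 ct te tn fin.
have V2 := greedy_variation d'0 ct te tn fin'.
have V3 := fine_le fin fin' leT.
apply: (@le_trans _ _ (2 * fine (truncated_variation (d / 4) h c e) +
    2 * fine (truncated_variation (d' / 4) h c e))); last by lra.
apply: le_trans (lerD V1 V2); rewrite -big_split/=; apply: ler_sum => i _.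
have resB j : residual h t d j - residual h t d' j =
    h (greedy h t (d' / 2) j) - h (greedy h t (d / 2) j).
  by rewrite /residual opprB addrC addrA subrK.
rewrite !resB opprD addrACA -opprD [leRHS]addrC.
by apply: le_trans (ler_normD _ _) _; rewrite normrN.
Qed.

End residual.

(** Term [k.+1] of the first series of S plus term [k] of the second, without the powers of 3: the
    integrator is one level ahead because the residual of [f] at [eta k] meets the replacement of
    [g] at [theta k.+1]. *)
Definition level_term (R : realType) (E V : normedModType R)
    (f : R -> clinear E V) (g : R -> E) (eta theta : nat -> R) k c e : R :=
  eta k * fine (truncated_variation (theta k.+1 / 4) g c e) +
  theta k * fine (truncated_variation (eta k / 4) f c e).

(** * Bounds of increment sums by level terms *)

Section increment_bounds.
Context {R : realType} {E V : normedModType R}.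
Variables (f : R -> clinear E V) (g : R -> E) (eta theta : nat -> R) (c e : R).
Hypotheses (eta_gt0 : forall k, 0 < eta k) (theta_gt0 : forall k, 0 < theta k)
  (eta_noninc : forall k, eta k.+1 <= eta k)
  (theta_noninc : forall k, theta k.+1 <= theta k).
Let F k := truncated_variation (eta k / 4) f c e.
Let G k := truncated_variation (theta k / 4) g c e.
Hypotheses (F_fin : forall k, F k \is a fin_num)
  (G_fin : forall k, G k \is a fin_num).
Variables (n : nat) (x y : nat -> R).
Hypotheses (cx : c <= x 0%N) (xe : x n <= e)
  (xn : forall i, (i < n)%N -> x i <= x i.+1).
Hypotheses (cy : c <= y 0%N) (ye : y n <= e)
  (yn : forall i, (i < n)%N -> y i <= y i.+1).

Let ce : c <= e := le_trans cx (le_trans (nd_chain_le xn) xe).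

Let F_ge0 k : 0 <= fine (F k).
Proof.
by apply/fine_ge0/truncated_variation_ge0; rewrite // divr_ge0// ltW.
Qed.

Let G_ge0 k : 0 <= fine (G k).
Proof.
by apply/fine_ge0/truncated_variation_ge0; rewrite // divr_ge0// ltW.
Qed.

Let D k := incr_sum n (residual f x (eta k)) (residual g y (theta k)).

(** Refining the residual of [g] is paid for by the oscillation [eta k] of the residual of [f];
    refining the latter is then paid for by the new oscillation [theta k.+1]. *)
Lemma residual_sum_step k :
  `|D k| <= 4 * (eta k * fine (G k.+1)) + 4 * (theta k.+1 * fine (F k.+1))
            + `|D k.+1|.
Proof.
have resK (W : normedModType R) (h : R -> W) t d d' :
    (fun i => residual h t d i - (residual h t d i - residual h t d' i)) =
    residual h t d'.
  by apply/funext => i; rewrite opprB addrC subrK.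
rewrite {1}/D (incr_sumBr _ _ _ (fun i =>
  residual g y (theta k) i - residual g y (theta k.+1) i)) resK.
apply: le_trans (ler_normD _ _) _; rewrite -addrA; apply: lerD.
  apply: le_trans (incr_sum_lel (m := eta k) _ _) _.
    by move=> i _; apply: residual_dist; exact: ltW.
  rewrite mulrCA ler_pM2l//.
  by apply: residualB_variation => //; [exact: ltW|exact: G_fin].
rewrite (incr_sumBl _ _ (fun i =>
  residual f x (eta k) i - residual f x (eta k.+1) i)) resK.
apply: le_trans (ler_normD _ _) _; apply: lerD => //.
apply: le_trans (incr_sum_ler (m := theta k.+1) _ _) _.
  by move=> i _; apply: residual_dist; exact: ltW.
rewrite mulrCA ler_pM2l//.
by apply: residualB_variation => //; [exact: ltW|exact: F_fin].
Qed.

Lemma residual_sum_small k : `|D k| <= n%:R * (eta k * theta k).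
Proof.
rewrite mulrCA; apply: le_trans (incr_sum_lel (m := eta k) _ _) _.
  by move=> i _; apply: residual_dist; exact: ltW.
rewrite ler_pM2l//; apply: (@le_trans _ _ (\sum_(i < n) theta k)).
  by apply: ler_sum => i _; apply: residual_dist; exact: ltW.
by rewrite sumr_const card_ord mulr_natl.
Qed.

Let w k := level_term f g eta theta k c e.

Let wE k : w k = eta k * fine (G k.+1) + theta k * fine (F k).
Proof. by []. Qed.

(** The term with [theta N] is carried on the left to close the induction: it completes [w N], while
    the term with [theta N.+1] from [residual_sum_step] is absorbed by the hypothesis at [N.+1]. *)
Lemma residual_sum_le N m :
  4 * (theta N * fine (F N)) + `|D N| <=
  4 * (\sum_(N <= k < (N + m).+1) w k)
  + n%:R * (eta (N + m)%N * theta (N + m)%N).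
Proof.
elim: m N => [|m IHm] N.
  rewrite addn0 big_nat1; apply: lerD (residual_sum_small _).
  by rewrite ler_pM2l// wE lerDr mulr_ge0// ltW.
have := IHm N.+1; rewrite addSnnS => IH.
rewrite big_ltn ?ltnS ?leq_addr// mulrDr -addrA.
apply: le_trans (lerD (lexx _) IH).
have := residual_sum_step N; rewrite wE /level_term -/(F _) -/(G _); lra.
Qed.

(** With the oscillation of [f] under control, [g] is replaced first; its residual then pays for
    replacing [f]. *)
Lemma incr_sum_le_residual k (m : R) :
  (forall i, (i <= n)%N -> `|f (x i) - f (x 0%N)| <= m) ->
  `|incr_sum n (f \o x) (g \o y)| <=
  2 * (m * fine (G k)) + 2 * (theta k * fine (F k)) + `|D k|.
Proof.
move=> fm.
rewrite (incr_sumBr _ _ _ (fun i => g (greedy g y (theta k / 2) i))).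
apply: le_trans (ler_normD _ _) _; rewrite -addrA; apply: lerD.
  apply: le_trans (incr_sum_lel _ fm) _; rewrite mulrCA.
  apply: ler_wpM2l; first exact: le_trans (fm _ (leq0n n)).
  by apply: greedy_variation => //; [exact: ltW|exact: G_fin].
rewrite (incr_sumBl _ _ (fun i => f (greedy f x (eta k / 2) i))).
apply: le_trans (ler_normD _ _) _; apply: lerD => //.
apply: le_trans (incr_sum_ler (m := theta k) _ _) _.
  by move=> i _; apply: residual_dist; exact: ltW.
by rewrite mulrCA ler_pM2l//; apply: greedy_variation => //; [exact: ltW|exact: F_fin].
Qed.

(** Mirror image: [f] is replaced first, and the same [D k] remains. *)
Lemma incr_sum_le_residual_integrator k :
  (forall i, (i <= n)%N -> `|g (y n) - g (y i)| <= theta k) ->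
  `|incr_sum n (f \o x) (g \o y)| <=
  2 * (eta k * fine (G k)) + 2 * (theta k * fine (F k)) + `|D k|.
Proof.
move=> gm; rewrite [X in _ <= X + _]addrC -addrA.
rewrite (incr_sumBl _ _ (fun i => f (greedy f x (eta k / 2) i))).
apply: le_trans (ler_normD _ _) _; apply: lerD.
  apply: le_trans (incr_sum_ler (X := g \o y) _ gm) _; rewrite mulrCA ler_pM2l//.
  by apply: greedy_variation => //; [exact: ltW|exact: F_fin].
rewrite (incr_sumBr _ _ _ (fun i => g (greedy g y (theta k / 2) i))).
apply: le_trans (ler_normD _ _) _; apply: lerD => //.
apply: le_trans (incr_sum_lel (m := eta k) _ _) _.
  by move=> i _; apply: residual_dist; exact: ltW.
by rewrite mulrCA ler_pM2l//; apply: greedy_variation => //; [exact: ltW|exact: G_fin].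
Qed.

Lemma incr_sum_le (m : R) r :
  (forall i, (i <= n)%N -> `|f (x i) - f (x 0%N)| <= m) ->
  `|incr_sum n (f \o x) (g \o y)| <=
  2 * (m * fine (G 0%N)) + 4 * (\sum_(0 <= k < r.+1) w k)
  + n%:R * (eta r * theta r).
Proof.
move=> fm; have := incr_sum_le_residual 0 fm.
have := residual_sum_le 0 r; rewrite add0n.
have : 0 <= theta 0%N * fine (F 0%N) by rewrite mulr_ge0// ltW.
lra.
Qed.

Lemma incr_sum_le_local N m :
  (forall s t, c <= s <= e -> c <= t <= e -> `|f s - f t| <= eta N) \/
  (forall s t, c <= s <= e -> c <= t <= e -> `|g s - g t| <= theta N) ->
  `|incr_sum n (f \o x) (g \o y)| <=
  6 * (\sum_(N <= k < (N + m).+1) w k)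
  + n%:R * (eta (N + m)%N * theta (N + m)%N).
Proof.
move=> osc.
have in_ce t : c <= t 0%N -> t n <= e -> (forall i, (i < n)%N -> t i <= t i.+1) ->
    forall i, (i <= n)%N -> c <= t i <= e.
  move=> ct te tn i ltin; apply/andP; split.
    by apply: le_trans ct (nd_chain_le _) => j ji; exact/tn/(leq_trans ji).
  apply: le_trans te; have := nd_chain_le (t := fun j => t (i + j)%N) (n := n - i).
  rewrite addn0 subnKC//; apply => j; rewrite ltn_subRL addnS; exact: tn.
have incr_le : `|incr_sum n (f \o x) (g \o y)| <=
    2 * (eta N * fine (G N)) + 2 * (theta N * fine (F N)) + `|D N|.
  case: osc => osc.
    by apply: incr_sum_le_residual => i ?; apply: osc; exact: in_ce.
  by apply: incr_sum_le_residual_integrator => i ?; apply: osc; exact: in_ce.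
have Fpos : 0 <= theta N * fine (F N) by rewrite mulr_ge0// ltW.
(* [G N] has a larger threshold than the [G N.+1] inside [w N], so it costs two further copies of
   the sum: 6 = 2 + 4. *)
have GN : eta N * fine (G N) <= \sum_(N <= k < (N + m).+1) w k.
  rewrite big_ltn ?ltnS ?leq_addr// -[leLHS]addr0 lerD//.
    rewrite wE -[leLHS]addr0 lerD// ler_pM2l//; apply: fine_le => //.
    by apply: le_truncated_variation => //; rewrite ler_pM2r.
  by apply: sumr_ge0 => k _; rewrite wE addr_ge0// mulr_ge0// ltW.
have := residual_sum_le N m; lra.
Qed.

End increment_bounds.

(** * Small oscillation of one of two functions on short intervals *)

Section oscillation.
Context {R : realType}.

Lemma continuity_radius (W : normedModType R) (h : R -> W) a b t p : 0 < p ->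
  h x @[x --> within [set` `[a, b]] (nbhs t)] --> h t ->
  exists2 r : R, 0 < r & forall s, a <= s <= b -> `|t - s| < r ->
    `|h t - h s| <= p.
Proof.
move=> p0 /cvgrPdist_le/(_ _ p0); rewrite near_withinE.
move=> /nbhs_ballP[r /= r0 hr]; exists r => // s sab tsr.
by apply: hr => //=; rewrite in_itv.
Qed.

(** At every point [f] or [g] is continuous, so it oscillates little on short intervals nearby;
    compactness of [[a, b]] makes the length uniform. *)
Lemma small_oscillation (W W' : normedModType R) (f : R -> W) (g : R -> W')
    a b p q : 0 < p -> 0 < q ->
  discontinuities a b f `&` discontinuities a b g = set0 ->
  exists2 r : R, 0 < r & forall c e, a <= c -> c <= e -> e <= b -> e - c < r ->
    (forall s t, c <= s <= e -> c <= t <= e -> `|f s - f t| <= p) \/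
    (forall s t, c <= s <= e -> c <= t <= e -> `|g s - g t| <= q).
Proof.
move=> p0 q0 fg.
pose small r := fun c e : R => e - c < r ->
    (forall s t, c <= s <= e -> c <= t <= e -> `|f s - f t| <= p) \/
    (forall s t, c <= s <= e -> c <= t <= e -> `|g s - g t| <= q).
pose P (r x : R) := forall c e, a <= c -> e <= b -> c <= x <= e -> small r c e.
have [r [r0 Pr]] :
    [set r : R | 0 < r /\ `[a, b]%classic `<=` P r] !=set0.
  apply: (@filter_ex _ (0 : R)^'+); apply: filterI; first exact: nbhs_right_gt.
  have /compact_near_coveringP cov := @segment_compact R a b.
  apply: (cov _ (0 : R)^'+ P) => x xab.
  have osc (W1 : normedModType R) (h : R -> W1) p1 : 0 < p1 ->
      h y @[y --> within [set` `[a, b]] (nbhs x)] --> h x ->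
      exists2 r : R, 0 < r & forall x' c e, a <= c -> e <= b ->
        c <= x' <= e -> `|x - x'| < r -> e - c < r ->
        forall s t, c <= s <= e -> c <= t <= e -> `|h s - h t| <= p1.
    move=> p10 /(continuity_radius (_ : 0 < p1 / 2))[|r r0 hr].
      by rewrite divr_gt0.
    (* One half of [r] bounds the distance from [x] to [x'], the other the length of the interval
       around [x']. *)
    exists (r / 2) => [|x' c e ac eb cx'e xx' ec s t cse cte].
      by rewrite divr_gt0.
    have near_x u : c <= u <= e -> `|h x - h u| <= p1 / 2.
      move=> /andP[cu ue]; move: cx'e => /andP[cx' x'e]; apply: hr.
        by rewrite (le_trans ac)//= (le_trans ue).
      rewrite -(subrKA x') (le_lt_trans (ler_normD _ _))//.
      rewrite [ltRHS]splitr ltrD// (le_lt_trans _ ec)// ler_norml.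
      by apply/andP; split; lra.
    rewrite -(subrKA (h x)) [leRHS]splitr (le_trans (ler_normD _ _))//.
    by rewrite lerD ?near_x// distrC near_x.
  have near_P r : 0 < r -> (forall x', `|x - x'| < r -> P r x') ->
      \forall x' \near x & i \near (0 : R)^'+, P i x'.
    move=> r0 Pr; exists (ball x r, [set i | i < r]) => /=.
      by split; [exact: nbhsx_ballx|exact: nbhs_right_lt].
    move=> [x' i] /= [xx' ir] c e ac eb cxe eci.
    by apply: (Pr x') => //; exact: lt_trans ir.
  have [|/contrapT fx] := pselect (~ (f y @[y --> within [set` `[a, b]] (nbhs x)] --> f x)).
    move=> fx; have gx : g y @[y --> within [set` `[a, b]] (nbhs x)] --> g x.
      apply: contrapT => gx.
      by have : set0 x by rewrite -fg.
    have [r r0 gr] := osc _ _ _ q0 gx; apply: (near_P r) => // x' xx' c e *.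
    by right; exact: (gr x').
  have [r r0 fr] := osc _ _ _ p0 fx; apply: (near_P r) => // x' xx' c e *.
  by left; exact: (fr x').
exists r => // c e ac ce eb ecr; apply: (Pr c) => //=.
  by rewrite in_itv/= ac (le_trans ce).
by rewrite lexx.
Qed.

End oscillation.

(** * Riemann-Stieltjes sums and common refinements *)

Section riemann_sums.
Context {R : realType} {E V : normedModType R}.
Variables (a b : R) (f : R -> clinear E V) (g : R -> E).

(* The points [clamp s_i s_(i+1) t_j] cut the i-th cell of a partition s at the
   points of a partition t, up to repetitions; summing over all pairs (i, j) gives
   the common refinement without merging the two partitions. *)
Definition clamp (s s' t : R) := Num.max s (Num.min t s').

Lemma clampl s s' t : t <= s -> s <= s' -> clamp s s' t = s.
Proof. by move=> ts ss'; rewrite /clamp max_l// ge_min ts. Qed.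

Lemma clampr s s' t : s' <= t -> s <= s' -> clamp s s' t = s'.
Proof. by move=> st ss'; rewrite /clamp min_r// max_r. Qed.

Lemma clamp_le s s' t t' : t <= t' -> clamp s s' t <= clamp s s' t'.
Proof. by move=> tt'; rewrite le_max2// le_min2. Qed.

(** Overlapping cells are cut to the same intersection from either side; otherwise both increments
    of [g] vanish. *)
Lemma clamp_swap s s' t t' : s <= s' -> t <= t' ->
  f (clamp s s' t) (g (clamp s s' t') - g (clamp s s' t)) =
  f (clamp t t' s) (g (clamp t t' s') - g (clamp t t' s)).
Proof.
move=> ss' tt'.
have [t's|st'] := leP t' s.
  rewrite (clampl t's)// (clampl (le_trans tt' t's))//.
  by rewrite (clampr t's)// (clampr (le_trans t's ss'))// !subrr !linear0.
have [s't|ts'] := leP s' t.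
  rewrite (clampl s't)// (clampl (le_trans ss' s't))//.
  by rewrite (clampr s't)// (clampr (le_trans s't tt'))// !subrr !linear0.
rewrite /clamp (min_l (ltW ts')) (min_l (ltW st')) (maxC t s).
have [sm tm] : s <= Num.min s' t' /\ t <= Num.min s' t'.
  by rewrite !le_min ss' tt' !ltW.
by rewrite (minC t') (max_r sm) (max_r tm).
Qed.

Definition cross_sum (P Q : tagged_partition a b) : V :=
  \sum_(i < tp_size P) \sum_(j < tp_size Q)
    let c := clamp (tp_point P i) (tp_point P i.+1) in
    f (c (tp_point Q j)) (g (c (tp_point Q j.+1)) - g (c (tp_point Q j))).

(** By symmetry, one comparison of [RS_sum] with [cross_sum] serves for both partitions. *)
Lemma cross_sumC P Q : cross_sum P Q = cross_sum Q P.
Proof.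
rewrite /cross_sum exchange_big/=; apply: eq_bigr => j _; apply: eq_bigr => i _.
by apply: clamp_swap; apply/ltW/tp_point_lt.
Qed.

Lemma tagged_sumE n (x y : nat -> R) :
  \sum_(i < n) f (x i.+1) (g (y i.+1) - g (y i)) =
  incr_sum n (f \o x) (g \o y) + f (x 0%N) (g (y n) - g (y 0%N)).
Proof.
elim: n => [|n IHn].
  by rewrite /incr_sum !big_ord0 subrr linear0 addr0.
rewrite big_ord_recr/= {}IHn incr_sumS clinearBl -!addrA; congr (_ + _).
rewrite -(subrKA (g (y n)) (g (y n.+1)) (- g (y 0%N))) (clinearDr _ (_ - _)).
by rewrite addKr addrC.
Qed.

Lemma tp_point_le (P : tagged_partition a b) i j :
  (i <= j)%N -> (j <= tp_size P)%N -> tp_point P i <= tp_point P j.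
Proof.
move=> ij jP; have := nd_chain_le (t := fun k => tp_point P (i + k)%N) (n := j - i).
rewrite addn0 subnKC//; apply => k; rewrite ltn_subRL addnS => ikj.
exact/ltW/tp_point_lt/(leq_trans ikj).
Qed.

Lemma tp_point_ge (P : tagged_partition a b) i : (i <= tp_size P)%N ->
  a <= tp_point P i.
Proof. by move=> iP; rewrite -[leLHS](tp_point0 P) tp_point_le. Qed.

Lemma tp_point_le_end (P : tagged_partition a b) i : (i <= tp_size P)%N ->
  tp_point P i <= b.
Proof. by move=> iP; rewrite -[leRHS](tp_pointn P) tp_point_le. Qed.

Lemma tp_width_le_mesh (P : tagged_partition a b) i : (i < tp_size P)%N ->
  tp_point P i.+1 - tp_point P i <= mesh P.
Proof.
by move=> iP; exact: (le_bigmax_cond _ (fun i : 'I_(tp_size P) =>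
  tp_point P i.+1 - tp_point P i) (isT : predT (Ordinal iP))).
Qed.

End riemann_sums.

Lemma le_of_le_add_cvg0 (R : realType) (u : nat -> R) (x y : R) :
  u m @[m --> \oo] --> 0 -> (forall m, x <= y + u m) -> x <= y.
Proof.
move=> u0 xyu; have yu : (y + u m) @[m --> \oo] --> y.
  by rewrite -[X in _ --> X]addr0; apply: cvgD; [exact: cvg_cst|].
rewrite -(cvg_lim _ yu)//; apply: limr_ge; first exact: cvgP yu.
exact: nearW.
Qed.

(** * Existence of the integral *)

Section existence.
Context {R : realType} {E : normedModType R} {V : completeNormedModType R}.
Variables (a b : R) (f : R -> clinear E V) (g : R -> E) (eta theta : nat -> R).
Hypotheses (ab : a < b)
  (fg_disc : discontinuities a b f `&` discontinuities a b g = set0)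
  (eta_gt0 : forall k, 0 < eta k) (theta_gt0 : forall k, 0 < theta k)
  (eta_noninc : forall k, eta k.+1 <= eta k)
  (theta_noninc : forall k, theta k.+1 <= theta k)
  (eta_cvg0 : eta k @[k --> \oo] --> 0)
  (theta_cvg0 : theta k @[k --> \oo] --> 0)
  (F_fin : forall k, truncated_variation (eta k / 4) f a b \is a fin_num)
  (G_fin : forall k, truncated_variation (theta k / 4) g a b \is a fin_num).

Lemma cvg_remainder (C : R) N :
  C * (eta (N + m)%N * theta (N + m)%N) @[m --> \oo] --> 0.
Proof.
rewrite -[X in _ --> X](mulr0 C); apply: cvgZl_tmp.
rewrite -[X in _ --> X](mulr0 0); under eq_fun do rewrite addnC.
by apply: cvgM; rewrite (cvg_shiftn N _ _).
Qed.

Lemma truncated_variation_sub_fin (W : normedModType R) (h : R -> W) d c e :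
  0 <= d -> a <= c -> c <= e -> e <= b ->
  truncated_variation d h a b \is a fin_num ->
  truncated_variation d h c e \is a fin_num.
Proof.
move=> d0 ac ce eb fin; rewrite ge0_fin_numE ?truncated_variation_ge0//.
apply: le_lt_trans (le_truncated_variation _ (lexx d) ac eb) _.
by rewrite ltey_eq fin.
Qed.

Lemma sum_fine_truncated_variation_le (W : normedModType R) (h : R -> W) d
    (P : tagged_partition a b) : 0 <= d ->
  truncated_variation d h a b \is a fin_num ->
  \sum_(i < tp_size P)
    fine (truncated_variation d h (tp_point P i) (tp_point P i.+1)) <=
  fine (truncated_variation d h a b).
Proof.
move=> d0 fin; rewrite -lee_fin -sumEFin fineK//.
have := @sum_truncated_variation_le _ _ h d (tp_size P) (tp_point P) d0
  (fun i iP => ltW (tp_point_lt iP)).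
rewrite tp_point0 tp_pointn; apply: le_trans.
rewrite le_eqVlt; apply/orP; left; apply/eqP/eq_bigr => i _.
rewrite fineK//; apply: truncated_variation_sub_fin => //.
- exact/tp_point_ge/ltnW.
- exact: tp_point_le.
- exact: tp_point_le_end.
Qed.

Lemma sum_level_term_le k (P : tagged_partition a b) :
  \sum_(i < tp_size P) level_term f g eta theta k (tp_point P i) (tp_point P i.+1) <=
  level_term f g eta theta k a b.
Proof.
rewrite big_split/= -!mulr_sumr lerD// ler_pM2l//.
  by apply: sum_fine_truncated_variation_le => //; rewrite divr_ge0// ltW.
by apply: sum_fine_truncated_variation_le => //; rewrite divr_ge0// ltW.
Qed.

Definition small_on N (c e : R) :=
  (forall s t, c <= s <= e -> c <= t <= e -> `|f s - f t| <= eta N) \/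
  (forall s t, c <= s <= e -> c <= t <= e -> `|g s - g t| <= theta N).

(** Both sums are compared with [f c (g e - g c)]. The differences are increment sums with 1 and [n]
    cells, so the constants are 12 = 6 + 6 and [n.+1]. *)
Lemma cell_le N m c e (xi : R) n (p : nat -> R) :
  a <= c -> e <= b -> small_on N c e -> c <= xi <= e ->
  p 0%N = c -> p n = e -> (forall j, (j < n)%N -> p j <= p j.+1) ->
  `|f xi (g e - g c) - \sum_(j < n) f (p j) (g (p j.+1) - g (p j))| <=
  12 * (\sum_(N <= k < (N + m).+1) level_term f g eta theta k c e)
  + n.+1%:R * (eta (N + m)%N * theta (N + m)%N).
Proof.
move=> ac eb osc /andP[cxi xie] p0 pn pnd.
have ce := le_trans cxi xie.
have Fce k : truncated_variation (eta k / 4) f c e \is a fin_num.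
  by apply: truncated_variation_sub_fin => //; rewrite divr_ge0// ltW.
have Gce k : truncated_variation (theta k / 4) g c e \is a fin_num.
  by apply: truncated_variation_sub_fin => //; rewrite divr_ge0// ltW.
pose x1 j := if j is 0%N then c else xi.
pose y1 j := if j is 0%N then c else e.
have -> : f xi (g e - g c) = incr_sum 1 (f \o x1) (g \o y1) + f c (g e - g c).
  by rewrite -(tagged_sumE f g 1 x1 y1) big_ord_recl big_ord0 addr0.
(* Tags are left end points, so [x] is [p] delayed by one index behind the base point [c]. *)
pose x j := if j is j'.+1 then p j' else c.
rewrite (tagged_sumE f g n x p) p0 pn opprD addrACA subrr addr0.
have xnd j : (j < n)%N -> x j <= x j.+1.
  by case: j => [_|j /ltnW]; [rewrite /x p0|exact: pnd].
have xe : x n <= e.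
  rewrite -pn; case: n {pn} xnd pnd => [|n] _ pnd; first by rewrite /x p0.
  exact: pnd.
have x1nd i : (i < 1)%N -> x1 i <= x1 i.+1 by case: i.
have y1nd i : (i < 1)%N -> y1 i <= y1 i.+1 by case: i.
have [cp pe] : c <= p 0%N /\ p n <= e by rewrite p0 pn.
have in1 := incr_sum_le_local eta_gt0 theta_gt0 eta_noninc theta_noninc Fce Gce
  (lexx c) xie x1nd (lexx c) (lexx e) y1nd m osc.
have in2 := incr_sum_le_local eta_gt0 theta_gt0 eta_noninc theta_noninc Fce Gce
  (lexx c) xe xnd cp pe pnd m osc.
apply: le_trans (ler_normB _ _) _; apply: le_trans (lerD in1 in2) _.
rewrite /level_term -natr1; lra.
Qed.

(** Superadditivity reassembles the cellwise bounds. The remainder grows with the partitions but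
    vanishes as [m] grows while they are fixed. *)
Lemma RS_sum_cross_sum_le N m r (P Q : tagged_partition a b) :
  (forall c e, a <= c -> c <= e -> e <= b -> e - c < r -> small_on N c e) ->
  mesh P < r ->
  `|RS_sum f g P - cross_sum f g P Q| <=
  12 * (\sum_(N <= k < (N + m).+1) level_term f g eta theta k a b)
  + ((tp_size P)%:R * (tp_size Q).+1%:R) * (eta (N + m)%N * theta (N + m)%N).
Proof.
move=> small Pr; rewrite -sumrB.
apply: le_trans (ler_norm_sum _ _ _) _.
apply: (@le_trans _ _ (\sum_(i < tp_size P) (
  12 * (\sum_(N <= k < (N + m).+1)
    level_term f g eta theta k (tp_point P i) (tp_point P i.+1))
  + (tp_size Q).+1%:R * (eta (N + m)%N * theta (N + m)%N)))).
  apply: ler_sum => i _.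
  have aP : a <= tp_point P i by apply/tp_point_ge/ltnW.
  have Pb : tp_point P i.+1 <= b by exact: tp_point_le_end.
  have PS : tp_point P i <= tp_point P i.+1 by exact: tp_point_le.
  apply: (cell_le m (p := fun j => clamp _ _ (tp_point Q j))) => //.
  - by apply: small => //; exact: le_lt_trans (tp_width_le_mesh _) Pr.
  - exact: tp_tag_in.
  - by rewrite clampl// (tp_point0 Q).
  - by rewrite clampr// (tp_pointn Q).
  - by move=> j jQ; apply: clamp_le; exact: tp_point_le.
rewrite big_split/= sumr_const card_ord -mulr_sumr -(mulrA _%:R).
rewrite (mulr_natl _ (tp_size P)) lerD2r ler_pM2l// exchange_big/=.
by apply: ler_sum => k _; exact: sum_level_term_le.
Qed.

Hypothesis level_sum_bounded :
  exists B, forall n, \sum_(0 <= k < n) level_term f g eta theta k a b <= B.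

(** Once a partial sum is within [p] of the supremum, what follows adds at most [p]. *)
Lemma level_sum_tail p : 0 < p ->
  exists N, forall m, \sum_(N <= k < (N + m).+1) level_term f g eta theta k a b <= p.
Proof.
move=> p0; have [B SB] := level_sum_bounded.
pose S := range (fun n => \sum_(0 <= k < n) level_term f g eta theta k a b).
have supS : has_sup S.
  split; first by exists (\sum_(0 <= k < 0) level_term f g eta theta k a b); exists 0%N.
  by exists B => _ [n _ <-].
have [_ [N _ <-] SN] := sup_adherent p0 supS.
exists N => m; have := ub_le_sup supS.2
  (imageT (fun n => \sum_(0 <= k < n) level_term f g eta theta k a b) (N + m).+1).
rewrite -/S (@big_cat_nat _ _ _ N)//=; last by rewrite leqW// leq_addr.
by move: SN; rewrite -/S; lra.
Qed.

Lemma RS_sum_cauchy p : 0 < p -> exists2 r, 0 < r &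
  forall P Q : tagged_partition a b, mesh P < r -> mesh Q < r ->
  `|RS_sum f g P - RS_sum f g Q| <= p.
Proof.
(* As 12 * (p / 24) = p / 2, each sum lies within [p / 2] of the cross sum. *)
move=> p0; have [|N tail] := @level_sum_tail (p / 24); first by rewrite divr_gt0.
have [r r0 small] := small_oscillation (eta_gt0 N) (theta_gt0 N) fg_disc.
exists r => // P Q Pr Qr.
have half (P1 Q1 : tagged_partition a b) : mesh P1 < r ->
    `|RS_sum f g P1 - cross_sum f g P1 Q1| <= p / 2.
  move=> P1r; apply: (le_of_le_add_cvg0
    (cvg_remainder ((tp_size P1)%:R * (tp_size Q1).+1%:R) N)) => m.
  apply: le_trans (RS_sum_cross_sum_le m Q1 small P1r) _.
  rewrite lerD2r; have := tail m; lra.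
rewrite -(subrKA (cross_sum f g P Q)) [leRHS]splitr.
apply: le_trans (ler_normD _ _) _; rewrite lerD ?half//.
by rewrite cross_sumC distrC half.
Qed.

(** The sums of mesh below [r] generate a Cauchy filter in the complete space [V]; its limit is
    reached along every sequence of partitions with vanishing mesh. *)
Lemma RS_integral_exists : exists I : V, is_RS_integral a b f g I.
Proof.
pose B (r : R) :=
  [set RS_sum f g P | P in [set P : tagged_partition a b | mesh P < r]].
pose Fl := filter_from [set r : R | 0 < r] B.
have Fl_proper : ProperFilter Fl.
  apply: filter_from_proper => [|r /= r0].
    apply: filter_from_filter; first by exists 1 => /=.
    move=> r s /= r0 s0; exists (Num.min r s); first by rewrite /= lt_min r0.
    by move=> _ [P /= + <-]; rewrite lt_min => /andP[Pr Ps]; split; exists P.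
  have [n nr] : exists n, (b - a) / n.+1%:R < r.
    have : (b - a) * n.+1%:R^-1 @[n --> \oo] --> (b - a) * 0.
      by apply: cvgZl_tmp; exact: cvg_harmonic.
    by rewrite mulr0 => /cvgr_lt/(_ _ r0)/filter_ex.
  have [P Pm] := mesh_uniform n ab.
  by exists (RS_sum f g P); exists P => //=; rewrite Pm.
have /cauchy_cvg/cvg_ex[I FlI] : cauchy Fl.
  apply/cauchy_ballP => p p0.
  have [|r r0 Pr] := @RS_sum_cauchy (p / 2); first by rewrite divr_gt0.
  exists (B r, B r) => [|[_ _] /= [[P Pm <-] [Q Qm <-]]].
    by split; exists r.
  rewrite -ball_normE/=; apply: le_lt_trans (Pr _ _ Pm Qm) _; lra.
exists I => P Pm; apply: cvg_trans FlI => A [r /= r0 BA].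
have : \forall n \near \oo, mesh (P n) < r by exact: cvgr_lt Pm _ r0.
by apply: filterS => n nr; apply: BA; exists (P n).
Qed.

End existence.

(** * Finiteness of the data and of partial sums when S is finite *)

Section finite_bound.
Context {R : realType} {E V : normedModType R}.
Variables (a b : R) (f : R -> clinear E V) (g : R -> E) (eta theta : nat -> R).
Hypotheses (ab : a < b)
  (eta_gt0 : forall k, 0 < eta k) (theta_gt0 : forall k, 0 < theta k)
  (theta_noninc : forall k, theta k.+1 <= theta k)
  (S_fin : (S_bound a b f g eta theta < +oo)%E).

Local Open Scope ereal_scope.

Let F k := truncated_variation (eta k / 4) f a b.
Let G k := truncated_variation (theta k / 4) g a b.
Let SG := \sum_(0 <= k <oo) (3 ^+ k)%:E * eta_pred a b f eta k * G k.
Let SF := \sum_(0 <= k <oo) (3 ^+ k)%:E * (theta k)%:E * F k.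

Let F_ge0 k : 0 <= F k.
Proof. by apply: truncated_variation_ge0; rewrite ?divr_ge0// ltW. Qed.

Let G_ge0 k : 0 <= G k.
Proof. by apply: truncated_variation_ge0; rewrite ?divr_ge0// ltW. Qed.

Let eta_pred_ge0 k : 0 <= eta_pred a b f eta k.
Proof.
case: k => [|k]; last by rewrite lee_fin ltW.
rewrite mule_ge0 ?lee_fin//; apply: ereal_sup_ubound; exists a.
  by rewrite /= in_itv/= lexx ltW.
by rewrite subrr normr0.
Qed.

Let termG_ge0 k : 0 <= (3 ^+ k)%:E * eta_pred a b f eta k * G k.
Proof. by rewrite !mule_ge0// lee_fin exprn_ge0. Qed.

Let termF_ge0 k : 0 <= (3 ^+ k)%:E * (theta k)%:E * F k.
Proof. by rewrite !mule_ge0// lee_fin ?exprn_ge0// ltW. Qed.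

Let SG_ge0 : 0 <= SG. Proof. exact: nneseries_ge0. Qed.
Let SF_ge0 : 0 <= SF. Proof. exact: nneseries_ge0. Qed.

Lemma S_bound_fin_num : S_bound a b f g eta theta \is a fin_num.
Proof. by rewrite ge0_fin_numE// adde_ge0// mule_ge0. Qed.

Let fin_factor (x y : \bar R) (r : R) : (0 < r)%R -> 0 <= x ->
  r%:E * x <= y -> y \is a fin_num -> x \is a fin_num.
Proof.
move=> r0 x0 xy yfin; rewrite ge0_fin_numE// ltey; apply/eqP => xoo.
move: xy; rewrite xoo gt0_muley ?lte_fin// leye_eq => /eqP yoo.
by rewrite yoo in yfin.
Qed.

Let SG_fin : SG \is a fin_num.
Proof.
apply: (fin_factor (r := 4) _ SG_ge0 _ S_bound_fin_num) => //.
by rewrite leeDl// mule_ge0.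
Qed.

Let SF_fin : SF \is a fin_num.
Proof.
apply: (fin_factor (r := 4) _ SF_ge0 _ S_bound_fin_num) => //.
by rewrite leeDr// mule_ge0.
Qed.

Lemma S_bound_fin_integrand k : F k \is a fin_num.
Proof.
apply: (fin_factor (r := 3 ^+ k * theta k) _ (F_ge0 k) _ SF_fin).
  by rewrite mulr_gt0// exprn_gt0.
rewrite EFinM; apply: le_trans (nneseries_lim_ge k.+1 (fun k _ _ => termF_ge0 k)).
by rewrite big_nat_recr//= leeDr// sume_ge0.
Qed.

(** The coefficient of [G 0] contains eta_{-1}, which is 0 for a constant [f]; so [G 0] is bounded
    by [G 1] instead. *)
Lemma S_bound_fin_integrator k : G k \is a fin_num.
Proof.
suff GS i : G i.+1 \is a fin_num.
  case: k => //; rewrite ge0_fin_numE//; apply: le_lt_trans (_ : _ <= G 1%N) _.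
    by apply: le_truncated_variation => //; rewrite ler_pM2r.
  by rewrite ltey_eq GS.
apply: (fin_factor (r := 3 ^+ i.+1 * eta i) _ (G_ge0 i.+1) _ SG_fin).
  by rewrite mulr_gt0// exprn_gt0.
rewrite EFinM; apply: le_trans (nneseries_lim_ge i.+2 (fun k _ _ => termG_ge0 k)).
by rewrite big_nat_recr//= leeDr// sume_ge0.
Qed.

(** Twice eta_{-1}, as a real number. *)
Definition osc_from_start : R :=
  fine (ereal_sup [set `|f t - f a|%:E | t in [set` `[a, b]%R]]).

Let osc_fin : ereal_sup [set `|f t - f a|%:E | t in [set` `[a, b]%R]] \is a fin_num.
Proof.
have : ereal_sup [set `|f t - f a|%:E | t in [set` `[a, b]%R]]
    <= (fine (F 0%N) + eta 0%N / 4)%:E.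
  apply: ge_ereal_sup => _ [t /= + <-]; rewrite in_itv/= => /andP[at_ tb].
  have d0 : (0 <= eta 0%N / 4)%R by rewrite divr_ge0// ltW.
  (* The one-step chain from [a] to [t] gives [|f t - f a| <= F 0 + eta 0 / 4]. *)
  pose x i := if i is 0%N then a else t.
  have xnd i : (i < 1)%N -> (x i <= x i.+1)%R by case: i.
  have := truncated_sum_le f (n := 1) (t := x) d0 (lexx a) tb xnd.
  rewrite big_ord_recl big_ord0 addr0/= -/(F 0%N).
  rewrite -(fineK (S_bound_fin_integrand 0)) !lee_fin ge_max => /andP[xF _].
  by rewrite -lerBlDr.
move=> osc_le; rewrite ge0_fin_numE ?(le_lt_trans osc_le) ?ltry//.
apply: ereal_sup_ubound; exists a; last by rewrite subrr normr0.
by rewrite /= in_itv/= lexx ltW.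
Qed.

Lemma le_osc_from_start t : (a <= t <= b)%R -> (`|f t - f a| <= osc_from_start)%R.
Proof.
move=> tab; rewrite -lee_fin fineK ?osc_fin//; apply: ereal_sup_ubound.
by exists t; rewrite //= in_itv.
Qed.

(** Term 0 of the first series is the isolated one, since 4 eta_{-1} is twice [osc_from_start]. In
    the others the powers of 3 are at least 1 and are dropped. *)
Lemma partial_sums_le_S_bound n :
  (2 * (osc_from_start * fine (G 0%N)) +
   4 * (\sum_(0 <= k < n) level_term f g eta theta k a b))%:E
  <= S_bound a b f g eta theta.
Proof.
apply: (@le_trans _ _
  (4%:E * (\sum_(0 <= k < n.+1) (3 ^+ k)%:E * eta_pred a b f eta k * G k)
   + 4%:E * (\sum_(0 <= k < n) (3 ^+ k)%:E * (theta k)%:E * F k))); last first.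
  by apply: leeD; apply: lee_wpmul2l => //; exact: nneseries_lim_ge.
pose e k := (if k is k'.+1 then eta k' else 2^-1 * osc_from_start)%R.
have eE k : eta_pred a b f eta k = (e k)%:E.
  by case: k => //=; rewrite EFinM fineK ?osc_fin.
have -> : \sum_(0 <= k < n.+1) (3 ^+ k)%:E * eta_pred a b f eta k * G k =
    (\sum_(0 <= k < n.+1) 3 ^+ k * e k * fine (G k))%R%:E.
  rewrite -sumEFin; apply: eq_bigr => k _.
  by rewrite eE !EFinM fineK ?S_bound_fin_integrator.
have -> : \sum_(0 <= k < n) (3 ^+ k)%:E * (theta k)%:E * F k =
    (\sum_(0 <= k < n) 3 ^+ k * theta k * fine (F k))%R%:E.
  rewrite -sumEFin; apply: eq_bigr => k _.
  by rewrite !EFinM fineK ?S_bound_fin_integrand.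
rewrite -!EFinM -EFinD lee_fin big_nat_recl//= expr0 mul1r.
rewrite [X in (_ <= X + _)%R]mulrDr -addrA lerD//.
  by move: (fine _) => G0; lra.
rewrite -mulrDr ler_pM2l// -big_split/=; apply: ler_sum => k _.
have one_le m : (1 <= 3 ^+ m :> R)%R by rewrite exprn_ege1// ler1n.
by rewrite lerD// -mulrA ler_peMl// mulr_ge0 ?fine_ge0 ?F_ge0 ?G_ge0// ltW.
Qed.

End finite_bound.

(** * The integral and its distance from the one-cell sum tagged at [a] *)

Theorem theorem2 (R : realType) (E V : completeNormedModType R) (a b : R)
    (f : R -> clinear E V) (g : R -> E) (eta theta : nat -> R)
    (ab : a < b)
    (f_reg : regulated a b f) (g_reg : regulated a b g)
    (fg_disc : discontinuities a b f `&` discontinuities a b g = set0)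
    (eta_gt0 : forall k, 0 < eta k) (theta_gt0 : forall k, 0 < theta k)
    (eta_noninc : forall k, eta k.+1 <= eta k)
    (theta_noninc : forall k, theta k.+1 <= theta k)
    (eta_cvg0 : eta k @[k --> \oo] --> 0)
    (theta_cvg0 : theta k @[k --> \oo] --> 0)
    (S_fin : (S_bound a b f g eta theta < +oo)%E) :
  exists2 I : V, is_RS_integral a b f g I &
    (`|I - f a (g b - g a)|%:E <= S_bound a b f g eta theta)%E.
Proof.
have Ffin := S_bound_fin_integrand ab eta_gt0 theta_gt0 S_fin.
have Gfin := S_bound_fin_integrator ab eta_gt0 theta_gt0 theta_noninc S_fin.
have partial := partial_sums_le_S_bound ab eta_gt0 theta_gt0 theta_noninc S_fin.
have osc := le_osc_from_start ab eta_gt0 theta_gt0 S_fin.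
have S_fin_num := S_bound_fin_num ab eta_gt0 theta_gt0 S_fin.
have G0 : 0 <= osc_from_start a b f *
    fine (truncated_variation (theta 0%N / 4) g a b).
  apply: mulr_ge0; first by apply: le_trans (normr_ge0 _) (osc a _); rewrite lexx ltW.
  by apply/fine_ge0/truncated_variation_ge0; rewrite ?divr_ge0 ?ltW.
have [I fgI] : exists I : V, is_RS_integral a b f g I.
  apply: (RS_integral_exists (eta := eta) (theta := theta)) => //.
  exists (fine (S_bound a b f g eta theta) / 4) => n.
  have := partial n; rewrite -(fineK S_fin_num) lee_fin; lra.
exists I => //.
have RS_le (P : tagged_partition a b) :
    `|RS_sum f g P - f a (g b - g a)| <= fine (S_bound a b f g eta theta).
  (* The tags are preceded by the base point [a], which splits off [f a (g b - g a)]. *)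
  pose x j := if j is j'.+1 then tp_tag P j' else a.
  have -> : RS_sum f g P = incr_sum (tp_size P) (f \o x) (g \o tp_point P)
      + f a (g b - g a).
    by have := tagged_sumE f g (tp_size P) x (tp_point P);
      rewrite tp_pointn tp_point0.
  rewrite addrK; have xab i : (i <= tp_size P)%N -> a <= x i <= b.
    case: i => [_|i iP]; first by rewrite lexx ltW.
    have /andP[Px xP] := tp_tag_in iP.
    rewrite (le_trans (tp_point_ge (ltnW iP)) Px).
    by rewrite (le_trans xP (tp_point_le_end iP)).
  have xnd i : (i < tp_size P)%N -> x i <= x i.+1.
    case: i => [|i] iP; first by case/andP: (xab _ iP).
    have /andP[_ xP] := tp_tag_in (ltnW iP); have /andP[Px _] := tp_tag_in iP.
    exact: le_trans xP Px.
  have x_osc i : (i <= tp_size P)%N -> `|f (x i) - f (x 0%N)| <= osc_from_start a b f.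
    by move=> iP; exact/osc/xab.
  (* [P] is fixed while [r] grows, so the remainder proportional to [tp_size P] disappears. *)
  apply: (le_of_le_add_cvg0
    (cvg_remainder eta_cvg0 theta_cvg0 (tp_size P)%:R 0)) => r.
  have /andP[_ xb] := xab _ (leqnn _).
  have pa : a <= tp_point P 0 by rewrite tp_point0.
  have pb : tp_point P (tp_size P) <= b by rewrite tp_pointn.
  apply: le_trans (incr_sum_le eta_gt0 theta_gt0 eta_noninc theta_noninc
    Ffin Gfin (lexx a) xb xnd pa pb (fun i iP => ltW (tp_point_lt iP)) r x_osc) _.
  by rewrite add0n lerD2r -lee_fin fineK.
(* [RS_le] holds for all partitions, so a single sequence with vanishing mesh transfers it to
   [I]. *)
have /choice[P meshP] : forall n, exists P : tagged_partition a b,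
  mesh P = (b - a) / n.+1%:R by move=> n; exact: mesh_uniform.
have P0 : mesh (P n) @[n --> \oo] --> 0.
  under eq_fun do rewrite meshP.
  by rewrite -(mulr0 (b - a)); apply: cvgZl_tmp; exact: cvg_harmonic.
rewrite -(fineK S_fin_num) lee_fin.
have : `|RS_sum f g (P n) - f a (g b - g a)| @[n --> \oo] --> `|I - f a (g b - g a)|.
  by apply: cvg_norm; apply: cvgB; [exact: fgI|exact: cvg_cst].
move=> lim; rewrite -(cvg_lim _ lim)//; apply: limr_le; first exact: cvgP lim.
by apply: nearW => n; exact: RS_le.
Qed.
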